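(* Let $S=\{f_1,\dots,f_m\}$ be a dimension regular self-similar IFS of $\mathbb{R}^d$ with contraction ratios $0<c_1,\dots,c_m<1$, such that its attractor $K$ satisfies $\dim_{sim}(K)=\dim_H(K)$. Then for any $x\in K$ and any $\delta\ge1$, $$\dim_H\Big(\limsup_{\underline{i}\in\Lambda^*}B\big(f_{\underline{i}}(x),c_{\underline{i}}^{\delta}\big)\Big)=\frac{\dim_H(K)}{\delta}.$$
   Context: A self-similar IFS of $\mathbb{R}^d$ is a family $S=\{f_i\}_{i=1}^m$ of $m\ge2$ contracting similarities; its attractor $K$ is the unique non-empty compact set with $K=\bigcup_if_i(K)$. Given a probability vector $(p_1,\dots,p_m)$ with positive entries, the associated self-similar measure is the unique probability measure $\mu$ with $\mu=\sum_ip_i\,\mu\circ f_i^{-1}$. Self-similar measures are exact dimensional, i.e. $\lim_{r\to0^+}\frac{\log\mu(B(x,r))}{\log r}$ exists and is a constant $\dim(\mu)$ for $\mu$-a.e. $x$. $S$ is dimension regular if for any probability vector $(p_1,\dots,p_m)$ the self-similar measure $\mu$ associated with $S$ and $(p_1,\dots,p_m)$ satisfies $\dim(\mu)=\min\Big\{d,\frac{\sum_{i}p_i\log p_i}{\sum_{i}p_i\log c_i}\Big\}$. $\dim_{sim}(K)$ is the unique real $s$ with $\sum_{i=1}^mc_i^s=1$. $\Lambda=\{1,\dots,m\}$, $\Lambda^*=\bigcup_{k\ge0}\Lambda^k$; for $\underline{i}=(i_1,\dots,i_k)$, $c_{\underline{i}}=c_{i_1}\cdots c_{i_k}$ and $f_{\underline{i}}=f_{i_1}\circ\cdots\circ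 f_{i_k}$. $B(x,r)$ is the closed ball for $\|\cdot\|_\infty$. $\limsup_{\underline{i}\in\Lambda^*}A_{\underline{i}}$ is the set of points belonging to $A_{\underline{i}}$ for infinitely many $\underline{i}\in\Lambda^*$. *)

(* Defs.v *)
From mathcomp Require Import all_boot all_order all_algebra.
From mathcomp Require Import all_classical all_reals all_analysis.
Import Order.TTheory GRing.Theory Num.Theory.
Import numFieldNormedType.Exports.

Set Implicit Arguments.
Unset Strict Implicit.
Unset Printing Implicit Defensive.

Local Open Scope classical_set_scope.
Local Open Scope ring_scope.

(* R^d is 'rV[R]_d, whose library norm `|x| (hence also closed_ball and the
   topology) is the sup norm. *)

Section hausdorff_dimension.
Context {R : realType} {V : normedModType R}.
Local Open Scope ereal_scope.

(* Equals -oo on set0. *)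
Definition diameter (U : set V) : \bar R :=
  ereal_sup [set (`|x - y|%R)%:E | x in U & y in U].

(* With the library convention 0 `^ 0 = 1, the empty set has to be singled out
   for it to weigh 0 also when s = 0. *)
Definition diam_pow (s : R) (U : set V) : \bar R :=
  if U == set0 then 0 else diameter U `^ s.

Definition hausdorff_premeasure (e s : R) (E : set V) : \bar R :=
  ereal_inf [set \sum_(0 <= k <oo) diam_pow s (U k) | U in
    [set U : nat -> set V |
      E `<=` \bigcup_k U k /\ forall k, diameter (U k) <= e%:E]].

(* The premeasures are nonincreasing in e, so their limit as e tends to 0 from
   the right is their supremum. *)
Definition hausdorff_measure (s : R) (E : set V) : \bar R :=
  ereal_sup [set hausdorff_premeasure e s E | e in [set e : R | (0 < e)%R]].

Definition dim_H (E : set V) : \bar R :=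
  ereal_inf [set s%:E | s in
    [set s : R | (0 <= s)%R /\ hausdorff_measure s E = 0]].

End hausdorff_dimension.

Section self_similar_sets.
Context {R : realType} {d m : nat}.
Implicit Types (f : 'I_m -> 'rV[R]_d -> 'rV[R]_d) (c p : 'I_m -> R).

Definition euclidean_norm (x : 'rV[R]_d) : R :=
  Num.sqrt (\sum_(j < d) x ord0 j ^+ 2).

Definition similarity (g : 'rV[R]_d -> 'rV[R]_d) (r : R) : Prop :=
  forall x y, euclidean_norm (g x - g y) = r * euclidean_norm (x - y).

Definition self_similar_IFS f c : Prop :=
  (2 <= m)%N /\ forall i, 0 < c i < 1 /\ similarity (f i) (c i).

Definition is_attractor f (K : set 'rV[R]_d) : Prop :=
  [/\ K !=set0, compact K & K = \bigcup_i (f i @` K)].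

Definition positive_probability_vector p : Prop :=
  (forall i, 0 < p i) /\ \sum_(i < m) p i = 1.

Definition borel_Rd := g_sigma_algebraType (@open 'rV[R]_d).

Definition self_similar_measure f p (mu : probability borel_Rd R) : Prop :=
  forall A : set borel_Rd, measurable A ->
    mu A = (\sum_(i < m) (p i)%:E * mu (f i @^-1` A))%E.

(* mu is exact dimensional and dim(mu) = a. The quotient is extended-real
   valued because lne 0 = -oo. *)
Definition exact_dimension (mu : probability borel_Rd R) (a : R) : Prop :=
  {ae mu, forall x : 'rV[R]_d,
    (lne (mu (closed_ball x r)) * ((ln r)^-1)%:E)%E @[r --> 0^'+] --> a%:E}.

Definition dimension_regular f c : Prop :=
  forall p, positive_probability_vector p ->
  forall mu : probability borel_Rd R, self_similar_measure f p mu ->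
  exact_dimension mu
    (Num.min d%:R ((\sum_(i < m) p i * ln (p i)) /
                   (\sum_(i < m) p i * ln (c i)))).

Definition is_similarity_dimension c (s : R) : Prop :=
  \sum_(i < m) c i `^ s = 1.

(* Words (i_1, ..., i_k) are sequences over 'I_m, including the empty one. *)
Definition word_map f (w : seq 'I_m) : 'rV[R]_d -> 'rV[R]_d :=
  foldr (fun i g => f i \o g) idfun w.

Definition word_ratio c (w : seq 'I_m) : R := \prod_(i <- w) c i.

(* Infinitely many indices w, not infinitely many distinct sets A w. *)
Definition limsup_words (A : seq 'I_m -> set 'rV[R]_d) : set 'rV[R]_d :=
  [set y | infinite_set [set w | A w y]].

End self_similar_sets.

(* Main.v *)
(* Upper bound: let [q > s / delta] and [s < p' < delta * q]. The covering sum
   of the balls indexed by the words of length at least [n] is at most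
   [2 `^ q * (max_i c i ^+ n) `^ (delta * q - p')] times the sum of
   [c_w `^ p'] over all words [w], which is a geometric series of ratio
   [\sum_i c i `^ p' < 1].

   Lower bound: let [q < s / delta]. As [dim_H K = s], for small [r] the set [K]
   contains more than [r `^ (- (delta * q))], up to a constant factor, points
   that are far apart at scale [r], and the words of ratio about [r] reaching
   them give an alphabet of [N] letters with strongly separated cylinders. Write
   [a] in [[0, 1[] in base [N] and read its digits as letters of this alphabet,
   but from time to time insert a word that steers the point into the ball
   around [f_w x] of radius [c_w `^ delta], where [w] is the word read so far.
   These insertions are delayed until the cylinder [w] read after [k] digits
   still satisfies [N ^- k <= c_w `^ q]. The resulting map [phi] takes values in
   the limsup set and satisfies [`|a - b| <= C * `|phi a - phi b| `^ q], so the
   [q]-dimensional Hausdorff measure of the limsup set is nonzero. *)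

Require Import Defs.
From mathcomp Require Import all_boot all_order all_algebra.
From mathcomp Require Import all_classical all_reals all_analysis.
From mathcomp Require Import ring lra.
Import Order.TTheory GRing.Theory Num.Theory.
Import numFieldNormedType.Exports.
Local Open Scope classical_set_scope.
Local Open Scope ring_scope.

Set Implicit Arguments.
Unset Strict Implicit.
Unset Printing Implicit Defensive.

Lemma expr_lt_small (R : realType) (x e : R) : 0 <= x -> x < 1 -> 0 < e ->
  exists n, x ^+ n < e.
Proof.
move=> x0 x1 e0.
have /cvgr0_norm_lt/(_ e e0)[n _ /(_ n (leqnn n))] : x ^+ n @[n --> \oo] --> 0.
  by apply: cvg_expr; rewrite ger0_norm.
by rewrite /= normrX ger0_norm// => xn; exists n.
Qed.

(** * Word maps *)

Lemma normr_le_euclidean (R : realType) (d : nat) (x : 'rV[R]_d) :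
  `|x| <= euclidean_norm x.
Proof.
rewrite /Num.norm /= mx_normrE; apply: bigmax_le; first exact: sqrtr_ge0.
move=> [i j] _ /=; rewrite ord1 -sqrtr_sqr ler_wsqrtr//.
by rewrite (bigD1 j)//= lerDl sumr_ge0// => k _; exact: sqr_ge0.
Qed.

Lemma euclidean_le_normr (R : realType) (d : nat) (x : 'rV[R]_d) :
  euclidean_norm x <= Num.sqrt d%:R * `|x|.
Proof.
rewrite -[X in _ * X]ger0_norm// -sqrtr_sqr -sqrtrM ?ler0n// ler_wsqrtr//.
rewrite mulr_natl -[X in _ *+ X]card_ord -sumr_const ler_sum// => j _.
rewrite -ler_sqrt ?sqr_ge0// !sqrtr_sqr normr_id.
rewrite [leRHS]/Num.norm /= mx_normrE.
exact: (le_bigmax _ (fun ij : 'I_1 * 'I_d => `|x ij.1 ij.2|) (ord0, j)).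
Qed.

Lemma word_map_cat (R : realType) (d m : nat)
    (f : 'I_m -> 'rV[R]_d -> 'rV[R]_d) (u v : seq 'I_m) (z : 'rV[R]_d) :
  word_map f (u ++ v) z = word_map f u (word_map f v z).
Proof. by elim: u => //= i u ->. Qed.

Lemma word_ratio_cat (R : realType) (m : nat) (c : 'I_m -> R)
    (u v : seq 'I_m) :
  word_ratio c (u ++ v) = word_ratio c u * word_ratio c v.
Proof. exact: big_cat. Qed.

Lemma word_ratio_cons (R : realType) (m : nat) (c : 'I_m -> R) i
    (w : seq 'I_m) :
  word_ratio c (i :: w) = c i * word_ratio c w.
Proof. exact: big_cons. Qed.

Section words.
Context {R : realType} {d m : nat}.
Variables (f : 'I_m -> 'rV[R]_d -> 'rV[R]_d) (c : 'I_m -> R).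
Variables (K : set 'rV[R]_d).
Hypothesis ifs : self_similar_IFS f c.
Hypothesis attr : is_attractor f K.
Implicit Types (u v w : seq 'I_m) (y z : 'rV[R]_d).

(** Ratios are Euclidean while distances are measured in the sup norm; [A] is the cost of comparing
    the two. *)
Let A : R := Num.sqrt d%:R.

Lemma ratio_gt0 i : 0 < c i.
Proof. by case: ifs => _ /(_ i)[/andP[]]. Qed.

Lemma ratio_lt1 i : c i < 1.
Proof. by case: ifs => _ /(_ i)[/andP[]]. Qed.

Lemma ratio_bounds : exists2 kc : R * R, 0 < kc.1 <= 1 /\ 0 <= kc.2 < 1 &
  forall i, kc.1 <= c i <= kc.2.
Proof.
exists (\big[Num.min/1]_(i < m) c i, \big[Num.max/0]_(i < m) c i) => /=.
  split; last first.
    rewrite bigmax_ge_id/=; apply: bigmax_lt; first exact: ltr01.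
    by move=> i _; exact: ratio_lt1.
  rewrite bigmin_le_id andbT; apply: lt_bigmin; first exact: ltr01.
  by move=> i _; exact: ratio_gt0.
by move=> i; rewrite bigmin_le_cond// (le_bigmax _ c i).
Qed.

Lemma word_ratio_gt0 w : 0 < word_ratio c w.
Proof. by apply: prodr_gt0 => i _; exact: ratio_gt0. Qed.

Lemma word_ratio_le1 w : word_ratio c w <= 1.
Proof.
elim: w => [|i w IH]; first by rewrite /word_ratio big_nil.
rewrite word_ratio_cons mulr_ile1 ?IH//.
- exact/ltW/ratio_gt0.
- exact/ltW/word_ratio_gt0.
- exact/ltW/ratio_lt1.
Qed.

Lemma word_ratio_le_expr (C : R) w : (forall i, c i <= C) ->
  word_ratio c w <= C ^+ size w.
Proof.
move=> cC; elim: w => [|i w IH]; first by rewrite /word_ratio big_nil.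
rewrite word_ratio_cons /= exprS ler_pM// ?ltW ?ratio_gt0 ?word_ratio_gt0//.
Qed.

Lemma word_map_similarity w : similarity (word_map f w) (word_ratio c w).
Proof.
elim: w => [|i w IH] y z /=; first by rewrite /word_ratio big_nil mul1r.
by rewrite word_ratio_cons (ifs.2 i).2 IH mulrA.
Qed.

Lemma word_map_le w y z :
  `|word_map f w y - word_map f w z| <= A * word_ratio c w * `|y - z|.
Proof.
apply: le_trans (normr_le_euclidean _) _.
rewrite word_map_similarity [A * _]mulrC -mulrA ler_wpM2l//.
  exact/ltW/word_ratio_gt0.
exact: euclidean_le_normr.
Qed.

Lemma word_map_ge w y z :
  word_ratio c w * `|y - z| <= A * `|word_map f w y - word_map f w z|.
Proof.
rewrite /A; apply: le_trans; last exact: euclidean_le_normr.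
rewrite word_map_similarity ler_wpM2l//; first exact/ltW/word_ratio_gt0.
exact: normr_le_euclidean.
Qed.

Lemma word_map_attractor w z : K z -> K (word_map f w z).
Proof.
have [_ _ KE] := attr => Kz; elim: w => [//|i w IH] /=.
by rewrite KE; exists i => //; exists (word_map f w z).
Qed.

(** Code [y] letter by letter and stop once the ratio is at most [r]. The last letter loses at most
    a factor [k], and the bound [C ^+ n] on ratios forces a stop. *)
Lemma attractor_word (k C : R) y r :
  0 < k <= 1 -> 0 <= C < 1 -> (forall i, k <= c i <= C) ->
  K y -> 0 < r <= 1 ->
  exists w, exists2 z, K z /\ y = word_map f w z &
    k * r <= word_ratio c w <= r.
Proof.
move=> /andP[k0 k1] /andP[C0 C1] kcC Ky /andP[r0 r1].
have step n : exists w, exists2 z, K z /\ y = word_map f w z &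
    k * r <= word_ratio c w <= r \/ r < word_ratio c w /\ size w = n.
  elim: n => [|n [w [z [Kz yz] [wr|[rw wn]]]]].
  - exists [::], y => //; rewrite /word_ratio big_nil.
    (* The empty word has ratio 1, so it is already small enough only when [r = 1]. *)
    have [->|rn1] := eqVneq r 1; first by left; rewrite mulr1 k1 lexx.
    by right; split=> //; rewrite lt_neqAle rn1 r1.
  - by exists w, z => //; left.
  - have [_ _ KE] := attr; move: (Kz); rewrite {1}KE => -[i _ [z' Kz' zE]].
    exists (rcons w i), z'.
      by split=> //; rewrite -cats1 word_map_cat /= zE.
    rewrite -cats1 word_ratio_cat word_ratio_cons {2 4 6}/word_ratio big_nil.
    rewrite mulr1 size_cat addn1 wn.
    have [h|h] := leP (word_ratio c w * c i) r; [left|by right].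
    rewrite andbT mulrC ler_pM ?(ltW k0) ?(ltW r0) ?(ltW rw)//.
    by have /andP[] := kcC i.
have [n /ltW Cn] := expr_lt_small C0 C1 r0.
have [w [z Kyz [wr|[rw wn]]]] := step n; first by exists w, z.
have /(word_ratio_le_expr w) : forall i, c i <= C.
  by move=> i; case/andP: (kcC i).
by rewrite wn leNgt (le_lt_trans Cn rw).
Qed.
End words.

(** * Hausdorff measures *)

Section hausdorff.
Context {R : realType} {V : normedModType R}.
Implicit Types (U E : set V) (x y z : V).
Local Open Scope ereal_scope.

Lemma diameter_ge U x y : U x -> U y -> (`|x - y|%R)%:E <= diameter U.
Proof. by move=> Ux Uy; apply: ereal_sup_ubound; exists x => //; exists y. Qed.

Lemma diameter_le U (b : R) :
  (forall x y, U x -> U y -> `|x - y| <= b)%R -> diameter U <= b%:E.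
Proof.
by move=> Ub; apply: ge_ereal_sup => _ [x Ux [y Uy <-]]; rewrite lee_fin Ub.
Qed.

Lemma diam_pow_ge0 (q : R) U : 0 <= diam_pow q U.
Proof. by rewrite /diam_pow; case: ifP => // _; exact: poweR_ge0. Qed.

Lemma hausdorff_measure_ge0 (q : R) E : 0 <= hausdorff_measure q E.
Proof.
apply: (@le_trans _ _ (hausdorff_premeasure 1 q E)).
  apply: le_ereal_inf_tmp => _ [U _ <-].
  by apply: nneseries_ge0 => k _ _; exact: diam_pow_ge0.
by apply: ereal_sup_ubound; exists 1%R => //=.
Qed.

Lemma diam_pow_le U (b q : R) : (0 <= q)%R ->
  (forall x y, U x -> U y -> `|x - y| <= b)%R -> diam_pow q U <= (b `^ q)%:E.
Proof.
move=> q0 Ub; rewrite /diam_pow; case: ifPn => [_|/set0P[x Ux]].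
  by rewrite lee_fin powR_ge0.
have d0 : 0 <= diameter U by have := diameter_ge Ux Ux; rewrite subrr normr0.
have := diameter_le Ub; rewrite -poweR_EFin => db.
have b0 : 0 <= b%:E by exact: le_trans db.
by apply: gt0_ler_poweR => //; rewrite in_itv /= ?d0 ?b0 leey.
Qed.

Lemma diam_pow_ge U (b q : R) x y : (0 <= q)%R -> diameter U <= b%:E ->
  U x -> U y -> ((`|x - y| `^ q)%:E <= diam_pow q U < +oo).
Proof.
move=> q0 Ub Ux Uy; rewrite /diam_pow; case: ifPn => [/eqP U0|_].
  by rewrite U0 in Ux.
have d0 := diameter_ge Ux Uy.
rewrite poweR_lty ?(le_lt_trans Ub) ?ltry// andbT -poweR_EFin.
apply: gt0_ler_poweR => //; rewrite in_itv /= leey andbT ?lee_fin//.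
by apply: le_trans d0; rewrite lee_fin.
Qed.

(* The inequality makes the preimage under [phi] of a set of diameter [r] lie
   in an interval of length [2 C r `^ q], so that subadditivity of the Lebesgue
   measure on [[0, 1[] bounds every covering sum from below. *)
Lemma hausdorff_measure_neq0 E (phi : R -> V) (C q : R) : (0 < C)%R ->
  (0 <= q)%R -> (forall a, 0 <= a < 1 -> E (phi a))%R ->
  (forall a b, 0 <= a < 1 -> 0 <= b < 1 ->
    `|a - b| <= C * `|phi a - phi b| `^ q)%R ->
  hausdorff_measure q E != 0.
Proof.
move=> C0 q0 Ephi phiC; apply/eqP => H0.
(* With this threshold, intervals of length [2 * C * diam_pow q (U k)] have total length below 1,
   too short to cover [[0, 1[]. *)
have : hausdorff_premeasure 1 q E < (2 * C)^-1%:E.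
  apply: (@le_lt_trans _ _ 0); last by rewrite lte_fin invr_gt0 mulr_gt0.
  by rewrite -H0; apply: ereal_sup_ubound; exists 1%R => //=.
move=> /ereal_inf_lt[_ [U [EU Ud] <-]].
pose l k : R := fine (C%:E * diam_pow q (U k)).
have fin k : diam_pow q (U k) \is a fin_num.
  rewrite fin_numE; have [->|/set0P[x Ux]] := eqVneq (U k) set0.
    by rewrite /diam_pow eqxx.
  have /andP[h1 h2] := diam_pow_ge q0 (Ud k) Ux Ux.
  by rewrite gt_eqF ?lt_eqF// (lt_le_trans (ltNyr _) h1).
have lE k : (l k)%:E = C%:E * diam_pow q (U k) by rewrite fineK// fin_numM.
(* The center [g k] is any parameter that [phi] sends into [U k], or 0 if there is none. *)
have [g gP] : {g : nat -> R & forall k a, (0 <= a < 1)%R -> U k (phi a) ->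
    (`|a - g k| <= l k)%R}.
  apply: (@choice _ _ (fun k g => forall a, (0 <= a < 1)%R -> U k (phi a) ->
    (`|a - g| <= l k)%R)) => k.
  have [[b [b01 Ub]]|nb] := pselect (exists b, (0 <= b < 1)%R /\ U k (phi b)).
    exists b => a a01 Ua; apply: le_trans (phiC _ _ a01 b01) _.
    rewrite -lee_fin lE EFinM lee_wpmul2l ?lee_fin ?(ltW C0)//.
    by have /andP[] := diam_pow_ge q0 (Ud k) Ua Ub.
  by exists 0%R => a a01 Ua; exfalso; apply: nb; exists a.
pose I k : set R := [set` `[(g k - l k)%R, (g k + l k)%R]].
have muI k : lebesgue_measure (I k) <= (2 * C)%:E * diam_pow q (U k).
  rewrite lebesgue_measure_itv /=; case: ifPn => _; last first.
    by rewrite mule_ge0 ?diam_pow_ge0// lee_fin mulr_ge0// ltW.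
  rewrite EFinM -muleA -lE -EFinB -EFinM lee_fin; lra.
have mI k : measurable (I k) by exact: measurable_itv.
have sub : [set` `[0%R, 1%R[] `<=` \bigcup_k I k.
  move=> a; rewrite /= in_itv /= => a01.
  have [k _ Uk] := EU _ (Ephi _ a01); exists k => //=.
  by rewrite /I /= in_itv /= -ler_distl; exact: gP.
have : lebesgue_measure [set` `[0%R, 1%R[] <=
    \sum_(0 <= k <oo) lebesgue_measure (I k).
  exact: measure_sigma_subadditive.
rewrite lebesgue_measure_itv /= lte_fin ltr01 sube0 => le1.
rewrite ltNge => /negP; apply.
rewrite -(@lee_pmul2l _ (2 * C)%:E) ?lte_fin ?mulr_gt0// -EFinM divff;
  last first.
  by rewrite gt_eqF// mulr_gt0.
apply: le_trans le1 _; rewrite -nneseriesZl;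
  last by move=> k _; exact: diam_pow_ge0.
by apply: lee_nneseries => k _ //; exact: measure_ge0.
Qed.

End hausdorff.

(** * Separated subsystems *)

Section separation.
Context {R : realType} {V : normedModType R}.
Implicit Types (U E : set V) (x y z : V).
Local Open Scope ereal_scope.

(** Below the dimension the measure is nonzero, so the premeasure is positive at some scale [eh.1],
    which bounds all covering sums at that scale from below. *)
Lemma dim_H_cover_ge E (s t : R) : s%:E = dim_H E -> (0 <= t < s)%R ->
  exists2 eh : R * R, (0 < eh.1)%R /\ (0 < eh.2)%R &
    forall U : nat -> set V, E `<=` \bigcup_k U k ->
      (forall k, diameter (U k) <= eh.1%:E) ->
      eh.2%:E <= \sum_(0 <= k <oo) diam_pow t (U k).
Proof.
move=> sE /andP[t0 ts].
have Ht : hausdorff_measure t E != 0.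
  apply/eqP => Ht0; have : dim_H E <= t%:E by apply: ereal_inf_lbound; exists t.
  by rewrite -sE lee_fin leNgt ts.
apply: contrapT => H; move/eqP: Ht; apply.
apply/eqP; rewrite eq_le hausdorff_measure_ge0 andbT.
apply: ge_ereal_sup => _ [e /= e0 <-]; rewrite leNgt; apply/negP => pe.
(* The premeasure may be infinite, in which case 1 serves as [h]. *)
have [h h0 hp] : exists2 h : R, (0 < h)%R & h%:E <= hausdorff_premeasure e t E.
  case: (hausdorff_premeasure e t E) pe => [r|_|//].
    by rewrite lte_fin => r0; exists r.
  by exists 1%R => //; rewrite leey.
apply: H; exists (e, h) => //= U EU Ue; apply: le_trans hp _.
by apply: ereal_inf_lbound; exists U.
Qed.

Lemma separated_points E (t e h r : R) : (0 <= t)%R -> (0 < r)%R ->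
  (2 * r <= e)%R ->
  (forall U : nat -> set V, E `<=` \bigcup_k U k ->
      (forall k, diameter (U k) <= e%:E) ->
      h%:E <= \sum_(0 <= k <oo) diam_pow t (U k)) ->
  forall n, (n%:R * (2 * r) `^ t < h)%R ->
  exists2 y : nat -> V, forall i, (i < n)%N -> E (y i) &
    forall i j, (i < j < n)%N -> (r < `|y i - y j|)%R.
Proof.
move=> t0 r0 re hE; elim=> [|n IH] nh.
  by exists (fun=> 0%R) => // i j /andP[].
have {}IH : exists2 y : nat -> V, forall i, (i < n)%N -> E (y i) &
    forall i j, (i < j < n)%N -> (r < `|y i - y j|)%R.
  apply: IH; apply: le_lt_trans nh.
  by rewrite ler_wpM2r ?powR_ge0// ler_nat.
have [y Ey sepy] := IH.
have [x [Ex xy]] : exists x, E x /\ forall i, (i < n)%N -> (r < `|y i - x|)%R.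
  apply: contrapT => H.
  pose U k : set V := if (k < n)%N then [set x | (`|y k - x| <= r)%R] else set0.
  have Udist k a b : U k a -> U k b -> (`|a - b| <= 2 * r)%R.
    rewrite /U; case: ifP => //= _ ya yb.
    rewrite (le_trans (ler_distD (y k) _ _))// [X in (X + _)%R]distrC.
    by rewrite mulrDl mul1r lerD.
  have : h%:E <= \sum_(0 <= k <oo) diam_pow t (U k).
    apply: hE => [x Ex|k].
      apply: contrapT => xU; apply: H; exists x; split=> // i ilt.
      rewrite ltNge; apply/negP => xi; apply: xU; exists i => //.
      by rewrite /U ilt.
    apply: diameter_le => a b Ua Ub; exact: le_trans (Udist _ _ _ Ua Ub) re.
  rewrite (nneseries_split 0 n); last by move=> k _; exact: diam_pow_ge0.
  rewrite [X in _ + X]eseries0 ?adde0; last first.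
    by move=> k; rewrite add0n => nk _; rewrite /diam_pow /U ltnNge nk eqxx.
  rewrite leNgt => /negP; apply; apply: (@le_lt_trans _ _
    (n%:R * (2 * r) `^ t)%:E).
    rewrite add0n big_mkord.
    have -> : (n%:R * (2 * r) `^ t)%:E = \sum_(i < n) ((2 * r) `^ t)%:E.
      by rewrite sumEFin sumr_const card_ord mulr_natl.
    apply: lee_sum => i _; apply: diam_pow_le => // a b; exact: Udist.
  rewrite lte_fin; apply: le_lt_trans nh.
  by rewrite ler_wpM2r ?powR_ge0// ler_nat.
exists (fun i => if i == n then x else y i).
  move=> i; case: eqP => // /eqP ni.
  by rewrite ltnS leq_eqVlt (negbTE ni); exact: Ey.
move=> i j /andP[ij]; rewrite ltnS leq_eqVlt => /predU1P[jn|jn].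
  by rewrite jn eqxx -jn (ltn_eqF ij); apply: xy; rewrite -jn.
by rewrite (ltn_eqF jn) (ltn_eqF (ltn_trans ij jn)) sepy// ij.
Qed.

End separation.

(** * A strongly separated alphabet *)

Section subsystem.
Context {R : realType} {d m : nat}.
Variables (f : 'I_m -> 'rV[R]_d -> 'rV[R]_d) (c : 'I_m -> R).
Variables (K : set 'rV[R]_d).
Hypothesis d_gt0 : (0 < d)%N.
Hypothesis ifs : self_similar_IFS f c.
Hypothesis attr : is_attractor f K.

Let A : R := Num.sqrt d%:R.

Lemma sqrt_dim_ge1 : 1 <= A.
Proof. by rewrite -sqrtr1 ler_wsqrtr// ler1n. Qed.

Lemma attractor_bounded : exists2 D : R, 1 <= D &
  forall y z, K y -> K z -> `|y - z| <= D.
Proof.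
have [_ /compact_bounded[M [_ KM]] _] := attr.
pose B := `|M| + 1.
have {}KM y : K y -> `|y| <= B.
  by apply: KM; rewrite (le_lt_trans (ler_norm M))// ltrDl.
exists (B + B); first by rewrite /B; have := normr_ge0 M; lra.
by move=> y z Ky Kz; rewrite (le_trans (ler_normB _ _))// lerD ?KM.
Qed.

(* [rho `^ (- u) < N] makes the similarity dimension of the subsystem coded by
   [lam] exceed [u]; [sigma] witnesses the strong separation condition. *)
Lemma separated_subsystem (k C D s u : R) :
  0 < k <= 1 -> 0 <= C < 1 -> (forall i, k <= c i <= C) ->
  1 <= D -> (forall y z, K y -> K z -> `|y - z| <= D) ->
  s%:E = dim_H K -> 0 <= u < s ->
  exists N (rho sigma : R) (lam : nat -> seq 'I_m),
    [/\ (1 < N)%N, 0 < rho <= 1, 0 < sigma & rho `^ (- u) < N%:R] /\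
    (forall i, (i < N)%N ->
      (0 < size (lam i))%N /\ rho <= word_ratio c (lam i)) /\
    (forall i j y z, (i < N)%N -> (j < N)%N -> i <> j -> K y -> K z ->
      sigma <= `|word_map f (lam i) y - word_map f (lam j) z|).
Proof.
move=> kk CC kcC D1 KD sE /andP[u0 us].
pose t := (u + s) / 2.
have ut : u < t by rewrite /t; lra.
have ts : t < s by rewrite /t; lra.
have t0 : 0 <= t by apply: le_trans u0 (ltW ut).
have [[e h] /= [e0 h0] cov] := dim_H_cover_ge sE (introT andP (conj t0 ts)).
pose M := A * D.
have A1 := sqrt_dim_ge1.
have M1 : 1 <= M by rewrite /M; nra.
have M0 : 0 < M by lra.
have /andP[k0 k1] := kk.
(* [X] gathers the constants in [N%:R * (6 * r * M)]^ t <= r [^ (t - u) * X], to be made smaller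
   than [h]. *)
pose X := 2 * k `^ (- u) * (6 * M) `^ t.
have X0 : 0 < X.
  by rewrite mulr_gt0 ?mulr_gt0 ?powR_gt0// mulr_gt0.
pose h' := h / X / 2.
have h'0 : 0 < h' by rewrite !divr_gt0.
(* The bound 1/2 makes the letters nonempty words, the second keeps the covering balls of radius
   [3 * r * M] below the scale [e], and the third makes the weight of [N] such balls less than
   [h]. *)
pose r := Num.min (1 / 2) (Num.min (e / (6 * M)) (h' `^ (t - u)^-1)).
have r0 : 0 < r.
  rewrite /r !lt_min powR_gt0// andbT.
  by apply/andP; split; rewrite divr_gt0// mulr_gt0.
have r1 : r <= 1 / 2 by rewrite /r ge_min lexx.
have re : r <= e / (6 * M) by rewrite /r !ge_min lexx !orbT.
have rh : r <= h' `^ (t - u)^-1 by rewrite /r !ge_min lexx !orbT.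
have rtu : r `^ (t - u) <= h'.
  rewrite -[leRHS]powRr1 ?(ltW h'0)// -(@mulVf _ (t - u)) ?powRrM; last by lra.
  by apply: ge0_ler_powR => //; rewrite ?nnegrE ?powR_ge0//; lra.
pose rho := k * r.
have rho0 : 0 < rho by rewrite mulr_gt0.
have rho1 : rho <= 1 by rewrite /rho; nra.
have rhou1 : 1 <= rho `^ (- u).
  by rewrite -(powRr0 rho) ger_powR ?rho0//; lra.
pose N := (Num.truncn (rho `^ (- u))).+1.
have NU : rho `^ (- u) < N%:R by rewrite truncnS_gt.
have NL : N%:R <= 2 * rho `^ (- u).
  rewrite /N -natr1.
  have : (Num.truncn (rho `^ (- u)))%:R <= rho `^ (- u).
    by rewrite truncn_le powR_ge0.
  lra.
have Nh : N%:R * (2 * (3 * r * M)) `^ t < h.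
  have -> : 2 * (3 * r * M) = r * (6 * M) by ring.
  rewrite powRM ?(ltW r0)//; last by lra.
  have rt : r `^ t = r `^ (t - u) * r `^ u.
    by rewrite -powRD ?subrK// (gt_eqF r0) implybT.
  have ru : r `^ (- u) * r `^ u = 1.
    by rewrite powRN mulVf// gt_eqF// powR_gt0.
  apply: (@le_lt_trans _ _ (2 * (k `^ (- u) * r `^ (- u)) *
     (r `^ (t - u) * r `^ u * (6 * M) `^ t))).
    have -> : k `^ (- u) * r `^ (- u) = rho `^ (- u) by rewrite -powRM ?ltW.
    by rewrite rt ler_pM2r// !mulr_gt0 ?powR_gt0// mulr_gt0.
  rewrite [ltLHS](_ : _ = r `^ (t - u) * (r `^ (- u) * r `^ u) *
    X); last by rewrite /X; ring.
  rewrite ru mulr1 -ltr_pdivlMr//; apply: le_lt_trans rtu _.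
  by rewrite /h' ltr_pdivrMr// ltr_pMr ?divr_gt0 ?ltr1n.
have r3e : 2 * (3 * r * M) <= e.
  move: re; rewrite ler_pdivlMr ?mulr_gt0//; lra.
have r30 : 0 < 3 * r * M by rewrite mulr_gt0 // mulr_gt0.
have [y Ky sep] := separated_points t0 r30 r3e cov Nh.
have [lam lamP] : {lam : nat -> seq 'I_m & forall i, (i < N)%N ->
    (exists2 z, K z /\ y i = word_map f (lam i) z &
      k * r <= word_ratio c (lam i) <= r)}.
  apply: (@choice _ _ (fun i w => (i < N)%N ->
    (exists2 z, K z /\ y i = word_map f w z &
      k * r <= word_ratio c w <= r))) => i.
  have [iN|] := boolP (i < N)%N; last by exists [::].
  have [w wP] : exists w, exists2 z, K z /\ y i = word_map f w z &
      k * r <= word_ratio c w <= r.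
    by apply: (attractor_word ifs attr kk CC kcC (Ky _ iN)); lra.
  by exists w.
exists N, rho, (r * M), lam; split; first split => //.
- by rewrite /N ltnS truncn_gt0.
- by rewrite rho0.
- by rewrite mulr_gt0.
(* Each cylinder stays within [r * M] of its point [y i], and these points are more than [3 * r * M]
   apart, which leaves a gap [sigma = r * M]. *)
have near i z : (i < N)%N -> K z -> `|word_map f (lam i) z - y i| <= r * M.
  move=> iN Kz; have [z' [Kz' ->] /andP[_ wr]] := lamP i iN.
  apply: le_trans (word_map_le ifs _ _ _) _.
  rewrite -/A (_ : r * M = A * r * D); last by rewrite /M; ring.
  have w0 := ltW (word_ratio_gt0 ifs (lam i)).
  by rewrite ler_pM ?KD// ?ler_pM ?mulr_ge0//; lra.
split=> [i iN|i j z z' iN jN ij Kz Kz'].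
  have [z' [Kz' _] /andP[-> wr]] := lamP i iN; split=> //.
  rewrite lt0n; apply/eqP => /size0nil w0; move: wr.
  by rewrite w0 /word_ratio big_nil; lra.
have yij : 3 * r * M < `|y i - y j|.
  have [lij|lij|//] := ltngtP i j; first by rewrite sep// lij.
  by rewrite distrC sep// lij.
have := near i z iN Kz; have := near j z' jN Kz'.
have := ler_distD (word_map f (lam i) z) (y i) (y j).
have := ler_distD (word_map f (lam j) z') (word_map f (lam i) z) (y j).
rewrite [`|y i - word_map _ _ _|]distrC.
lra.
Qed.

End subsystem.

(** * The Cantor-like subset *)

Section digits.
Context {R : realType}.
Variable N : nat.
Hypothesis N_gt1 : (1 < N)%N.
Implicit Types (a b : R).

Let N_gt0 : (0 < N)%N := ltnW N_gt1.

Definition digit a k : nat := (Num.truncn (a * N%:R ^+ k.+1) %% N)%N.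

Lemma digit_lt a k : (digit a k < N)%N.
Proof. by rewrite ltn_mod. Qed.

Lemma truncn_digit a k : 0 <= a ->
  Num.truncn (a * N%:R ^+ k.+1) =
  (Num.truncn (a * N%:R ^+ k) * N + digit a k)%N.
Proof.
move=> a0; rewrite {1}(divn_eq (Num.truncn (a * N%:R ^+ k.+1)) N).
congr (_ * N + _)%N; apply/eqP; rewrite eq_sym truncn_eq; last first.
  by rewrite mulr_ge0// exprn_ge0.
have aN0 : 0 <= a * N%:R ^+ k.+1 by rewrite mulr_ge0// exprn_ge0.
have N0 : (0 : R) < N%:R by rewrite ltr0n.
apply/andP; split.
  rewrite -(ler_pM2r N0) -mulrA -exprSr -natrM -truncn_ge_nat//.
  exact: leq_divM.
by rewrite -(ltr_pM2r N0) -mulrA -exprSr -natrM -truncn_lt_nat// ltn_ceil.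
Qed.

(** By [truncn_digit], equal digits give [a * N%:R ^+ k] and [b * N%:R ^+ k] the same integer
    part. *)
Lemma eq_digits_dist a b k : 0 <= a < 1 -> 0 <= b < 1 ->
  (forall i, (i < k)%N -> digit a i = digit b i) -> `|a - b| <= N%:R ^- k.
Proof.
move=> /andP[a0 a1] /andP[b0 b1] dab.
have tab : Num.truncn (a * N%:R ^+ k) = Num.truncn (b * N%:R ^+ k).
  elim: k dab => [|k IH] dab; last first.
    by rewrite !truncn_digit// dab// IH// => i ik; apply: dab; exact: ltnW.
  rewrite !expr0 !mulr1 (@truncn_def _ a 0%N) ?a0 ?a1//.
  by rewrite (@truncn_def _ b 0%N) ?b0 ?b1.
have Nk0 : (0 : R) < N%:R ^+ k by rewrite exprn_gt0// ltr0n.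
have /andP[al ar] := truncn_itv (mulr_ge0 a0 (ltW Nk0)).
have /andP[bl br] := truncn_itv (mulr_ge0 b0 (ltW Nk0)).
rewrite -[leRHS]mul1r ler_pdivlMr// -[in leLHS](gtr0_norm Nk0) -normrM mulrBl.
move: al ar bl br; rewrite tab -natr1 ler_norml => al ar bl br; lra.
Qed.

Lemma neq_digit a b : 0 <= a < 1 -> 0 <= b < 1 -> a != b ->
  exists2 k, digit a k != digit b k &
    forall i, (i < k)%N -> digit a i = digit b i.
Proof.
move=> a01 b01 ab.
have ex : exists k, digit a k != digit b k.
  apply: contrapT => dab.
  have N1 : (N%:R^-1 : R) < 1 by rewrite invf_lt1 ?ltr1n ?ltr0n.
  have ab0 : 0 < `|a - b| by rewrite normr_gt0 subr_eq0.
  have [||k] := @expr_lt_small R N%:R^-1 _ _ _ ab0; rewrite ?invr_ge0//.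
  rewrite exprVn ltNge => /negP; apply; apply: eq_digits_dist => // i _.
  by apply/eqP; apply: contrapT => /negP di; apply: dab; exists i.
have := ex_minnP ex => -[k dk kmin]; exists k => // i ik.
by apply/eqP; apply: contraTT ik => /kmin; rewrite -leqNgt.
Qed.

End digits.

(** * Estimates passing to closures *)

Section closure_dist.
Context {R : realType} {V : normedModType R}.
Implicit Types (E F : set V) (y z : V).

Lemma closure_approx E y e : closure E y -> 0 < e ->
  exists2 a, E a & `|y - a| < e.
Proof.
move=> Ey e0; have [a [Ea]] := Ey _ (nbhsx_ballx y e e0).
by rewrite -ball_normE => ya; exists a.
Qed.

Lemma closure_dist_ge E F y z s : closure E y -> closure F z ->
  (forall a b, E a -> F b -> s <= `|a - b|) -> s <= `|y - z|.
Proof.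
move=> Ey Fz EF; apply/ler_addgt0Pr => e e0.
have e2 : 0 < e / 2 by rewrite divr_gt0.
have [a Ea ya] := closure_approx Ey e2; have [b Fb zb] := closure_approx Fz e2.
apply: le_trans (EF a b Ea Fb) _.
have := ler_distD y a b; have := ler_distD z y b.
rewrite [`|a - y|]distrC; lra.
Qed.

Lemma closure_dist_le E y z s : closure E y ->
  (forall a, E a -> `|a - z| <= s) -> `|y - z| <= s.
Proof.
move=> Ey Ez; apply/ler_addgt0Pr => e e0.
have [a Ea ya] := closure_approx Ey e0.
by have := ler_distD a y z; have := Ez a Ea; lra.
Qed.

End closure_dist.

(** * Addresses and their limit points *)

Section cantor.
Context {R : realType} {d m : nat}.
Variables (f : 'I_m -> 'rV[R]_d -> 'rV[R]_d) (c : 'I_m -> R).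
Variables (K : set 'rV[R]_d).
Hypothesis ifs : self_similar_IFS f c.
Hypothesis attr : is_attractor f K.

Variables (delta q : R) (x : 'rV[R]_d) (N : nat) (rho sigma kappa : R).
Variables (lam : nat -> seq 'I_m) (v : seq 'I_m -> seq 'I_m).
Hypothesis delta_ge1 : 1 <= delta.
Hypothesis q_ge0 : 0 <= q.
Hypothesis N_gt1 : (1 < N)%N.
Hypothesis rho01 : 0 < rho <= 1.
Hypothesis sigma_gt0 : 0 < sigma.
Hypothesis N_large : rho `^ (- (delta * q)) < N%:R.
Hypothesis lamP : forall i, (i < N)%N ->
  (0 < size (lam i))%N /\ rho <= word_ratio c (lam i).
Hypothesis lam_sep : forall i j y z, (i < N)%N -> (j < N)%N -> i <> j ->
  K y -> K z ->
  sigma <= `|word_map f (lam i) y - word_map f (lam j) z|.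
Hypothesis kappa_gt0 : 0 < kappa.
Hypothesis v_ratio : forall w,
  kappa * word_ratio c w `^ delta <= word_ratio c (w ++ v w).
Hypothesis v_near : forall w z, K z ->
  `|word_map f (w ++ v w) z - word_map f w x| <= word_ratio c w `^ delta.

Implicit Types (e : nat -> nat) (w : seq 'I_m).

Let A : R := Num.sqrt d%:R.

(** Numbers sharing [k] digits are within [N%:R ^- k], and images parting after [w] are at least
    about [word_ratio c w] apart, so this is the desired Hölder estimate at level [k]. *)
Definition admissible k w := N%:R ^- k <= word_ratio c w `^ q.

(* Appending [v w] steers the point into the ball around [word_map f w x]; this
   is done as soon as it does not spoil the invariant [admissible]. *)
Fixpoint address e k : seq 'I_m :=
  if k is k'.+1 then
    let w := address e k' ++ lam (e k') in
    if admissible k'.+1 (w ++ v w) then w ++ v w else w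
  else [::].

Lemma eq_address e e' k : (forall i, (i < k)%N -> e i = e' i) ->
  address e k = address e' k.
Proof.
elim: k => //= k IH ee; rewrite ee// IH// => i ik.
exact/ee/ltnW.
Qed.

Lemma address_prefix e k : exists t,
  address e k.+1 = (address e k ++ lam (e k)) ++ t.
Proof.
by rewrite /=; case: ifP => _; [eexists | exists [::]; rewrite cats0].
Qed.

Lemma address_prefixD e k l : exists t, address e (k + l) = address e k ++ t.
Proof.
elim: l => [|l [t IH]]; first by exists [::]; rewrite addn0 cats0.
have [t' E] := address_prefix e (k + l).
by exists (t ++ lam (e (k + l)%N) ++ t'); rewrite addnS E IH -!catA.
Qed.

Lemma size_address e k : (forall i, (e i < N)%N) -> (k <= size (address e k))%N.
Proof.
move=> eN; elim: k => [//|k IH]; have [t ->] := address_prefix e k.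
rewrite !size_cat -addnA -addn1 leq_add// addn_gt0.
by have [-> _] := lamP (eN k).
Qed.

(** The strict gap between these two rates is what eventually pays for each insertion. *)
Lemma invN_lt : N%:R^-1 < (rho `^ delta) `^ q.
Proof.
have rp : 0 < rho `^ (- (delta * q)) by rewrite powR_gt0//; case/andP: rho01.
rewrite -powRrM -[ltRHS]invrK -powRN ltf_pV2//.
by rewrite posrE (lt_trans rp).
Qed.

Lemma address_admissible e k : (forall i, (e i < N)%N) ->
  admissible k (address e k).
Proof.
move=> eN; elim: k => [|k IH].
  by rewrite /admissible /word_ratio big_nil powR1 expr0 invr1.
rewrite /=; case: ifP => // _; move: IH; rewrite /admissible => IH.
have /andP[r0 r1] := rho01.
rewrite word_ratio_cat powRM ?(ltW (word_ratio_gt0 ifs _))//.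
rewrite exprSr invfM ler_pM ?invr_ge0 ?exprn_ge0//.
apply: le_trans (ltW invN_lt) _; apply: ge0_ler_powR; rewrite ?nnegrE//.
- exact: powR_ge0.
- exact/ltW/(word_ratio_gt0 ifs).
- apply: (le_trans _ (lamP (eN k)).2).
  rewrite -[leRHS]powRr1 ?(ltW r0)//.
  by apply: ger_powR; rewrite ?r0.
Qed.

(** Without insertions after [k0], the ratio decays at most like [rho ^+ l], so its power
    [delta * q] decays more slowly than [N%:R ^- l]. Inserting [v w] then becomes admissible, a
    contradiction. *)
Lemma address_steered e k0 : (forall i, (e i < N)%N) ->
  exists2 k, (k0 <= k)%N & let w := address e k ++ lam (e k) in
    address e k.+1 = w ++ v w.
Proof.
move=> eN; apply: contrapT => H.
have /andP[r0 r1] := rho01.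
have adm k : (k0 <= k)%N ->
    let w := address e k ++ lam (e k) in
    address e k.+1 = w /\ ~~ admissible k.+1 (w ++ v w).
  move=> kk /=; case: ifPn => aw; last by split.
  by exfalso; apply: H; exists k => //=; rewrite aw.
pose r0' := word_ratio c (address e k0).
have r0'0 : 0 < r0' by exact: (word_ratio_gt0 ifs).
have low l : r0' * rho ^+ l <= word_ratio c (address e (k0 + l)).
  elim: l => [|l IH]; first by rewrite expr0 mulr1 addn0.
  rewrite addnS (adm _ (leq_addr _ _)).1 word_ratio_cat exprSr mulrA.
  rewrite ler_pM ?mulr_ge0 ?exprn_ge0 ?(ltW r0) ?(ltW r0'0)//.
  exact: (lamP (eN _)).2.
pose theta := (N%:R * (rho `^ delta) `^ q)^-1.
have N0 : (0 : R) < N%:R by rewrite ltr0n ltnW.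
have rdq0 : 0 < (rho `^ delta) `^ q by rewrite !powR_gt0.
have t0 : 0 <= theta by rewrite invr_ge0 mulr_ge0// ltW.
have t1 : theta < 1.
  by rewrite invf_lt1 ?mulr_gt0// -ltr_pdivrMl// mulr1 invN_lt.
(* Admissibility of the insertion at stage [k0 + l] follows from [theta ^+ l.+1 <= eps]; the
   exponent is [l.+1] because the test counts the digit just read. *)
pose eps := N%:R ^+ k0 * (kappa * r0' `^ delta) `^ q.
have eps0 : 0 < eps.
  by rewrite mulr_gt0 ?exprn_gt0// powR_gt0// mulr_gt0// powR_gt0.
have [l tl] := expr_lt_small t0 t1 eps0.
have tl1 : theta ^+ l.+1 <= eps.
  by apply: (le_trans _ (ltW tl)); rewrite exprS ler_piMl ?exprn_ge0// ltW.
have [aE /negP] := adm (k0 + l)%N (leq_addr _ _); apply.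
rewrite /admissible -aE -addnS; set w := address _ _.
have wl : r0' * rho ^+ l.+1 <= word_ratio c w by exact: low.
apply: (@le_trans _ _ ((kappa * word_ratio c w `^ delta) `^ q)); last first.
  apply: ge0_ler_powR => //; rewrite ?nnegrE ?mulr_ge0 ?powR_ge0 ?(ltW kappa_gt0)//.
  exact/ltW/(word_ratio_gt0 ifs).
apply: (@le_trans _ _ ((kappa * (r0' * rho ^+ l.+1) `^ delta) `^ q)); last first.
  have h0 : 0 <= r0' * rho ^+ l.+1 by rewrite mulr_ge0 ?exprn_ge0// ltW.
  apply: ge0_ler_powR => //; rewrite ?nnegrE ?mulr_ge0 ?powR_ge0 ?(ltW kappa_gt0)//.
  rewrite ler_pM2l//; apply: ge0_ler_powR; rewrite ?nnegrE//.
    exact: le_trans delta_ge1.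
  exact/ltW/(word_ratio_gt0 ifs).
have -> : (kappa * (r0' * rho ^+ l.+1) `^ delta) `^ q =
    (kappa * r0' `^ delta) `^ q * ((rho `^ delta) `^ q) ^+ l.+1.
  rewrite [(r0' * _) `^ _]powRM ?(ltW r0'0) ?exprn_ge0 ?(ltW r0)// mulrA.
  rewrite powRM ?mulr_ge0 ?powR_ge0 ?(ltW kappa_gt0)//; congr (_ * _).
  rewrite -(powR_mulrn l.+1 (powR_ge0 _ _)) -(powR_mulrn l.+1 (ltW r0)).
  by rewrite -!powRrM; congr powR; ring.
rewrite exprD invfM -ler_pdivlMl ?exprn_gt0// ?invr_gt0 ?exprn_gt0//.
move: tl1; rewrite /theta /eps exprVn exprMn invfM invrK.
by rewrite ler_pdivrMr ?exprn_gt0// mulrA.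
Qed.

(** The images of one point of [K] cluster by compactness, and from index [k] on they lie in the
    [k]-th cylinder. *)
Lemma address_limit e : exists y,
  forall k, closure (word_map f (address e k) @` K) y.
Proof.
have [[z0 Kz0] Kc _] := attr.
pose y k := word_map f (address e k) z0.
have Ky : (y @ \oo) K.
  by exists 0%N => // k _ /=; exact: word_map_attractor.
have [p [_ py]] := Kc _ _ Ky; exists p => k B nB.
apply: py => //; exists k => // l /= kl.
have [t E] := address_prefixD e k (l - k).
rewrite subnKC// in E.
exists (word_map f t z0); first exact: (word_map_attractor attr).
by rewrite /y E word_map_cat.
Qed.

Lemma closure_word_prefix u t y :
  closure (word_map f (u ++ t) @` K) y -> closure (word_map f u @` K) y.
Proof.
apply: closure_subset => _ [z Kz <-]; rewrite word_map_cat.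
by exists (word_map f t z) => //; exact: word_map_attractor.
Qed.

(** If only finitely many words qualified, their lengths would be bounded, but steered addresses
    occur at arbitrarily late stages and hence with arbitrary length. *)
Lemma address_limit_limsup e y : (forall i, (e i < N)%N) ->
  (forall k, closure (word_map f (address e k) @` K) y) ->
  limsup_words (fun w =>
    closed_ball (word_map f w x) (word_ratio c w `^ delta)) y.
Proof.
move=> eN ey fin.
pose S := [set w | closed_ball (word_map f w x) (word_ratio c w `^ delta) y].
have [n nP] : exists n, forall w, S w -> (size w <= n)%N.
  have [s sE] := (finite_seqP S).1 fin.
  exists (\max_(w <- s) size w)%N => w Sw.
  by apply: (@leq_bigmax_seq _ s xpredT size w) => //; move: Sw; rewrite sE.
have [k nk E] := address_steered n.+1 eN.
set w := address e k ++ lam (e k) in E.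
have Sw : S w.
  rewrite /S /= closed_ballE ?powR_gt0 ?(word_ratio_gt0 ifs)//.
  rewrite /closed_ball_ /= distrC; apply: (closure_dist_le (ey k.+1)).
  by move=> _ [z Kz <-]; rewrite E; exact: v_near.
have := nP w Sw; rewrite leqNgt => /negP; apply; apply: leq_trans nk _.
by apply: leq_trans (size_address k eN) _; rewrite /w size_cat leq_addr.
Qed.

(** Both points lie beyond the common prefix [address e k], followed by distinct letters; the prefix
    scales the gap [sigma] by its ratio. *)
Lemma address_limit_dist e e' k y z :
  (forall i, (e i < N)%N) -> (forall i, (e' i < N)%N) ->
  (forall i, (i < k)%N -> e i = e' i) -> e k <> e' k ->
  (forall k, closure (word_map f (address e k) @` K) y) ->
  (forall k, closure (word_map f (address e' k) @` K) z) ->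
  word_ratio c (address e k) * sigma <= A * `|y - z|.
Proof.
move=> eN e'N ee eek ey ez.
have [t E] := address_prefix e k; have [t' E'] := address_prefix e' k.
have := ey k.+1; rewrite E => /closure_word_prefix {}ey.
have := ez k.+1; rewrite E' -(eq_address ee) => /closure_word_prefix {}ez.
have A0 : 0 <= A by exact: sqrtr_ge0.
(* In dimension 0 all points coincide, which contradicts separation by [sigma > 0]. *)
have [dz|d0] := posnP d.
  exfalso; have [[z0 Kz0] _ _] := attr.
  have := lam_sep (eN k) (e'N k) eek Kz0 Kz0; rewrite leNgt => /negP; apply.
  rewrite (_ : _ - _ = 0) ?normr0//.
  by apply/matrixP => i j; move: (ltn_ord j); rewrite {2}dz.
have {}A0 : 0 < A by rewrite sqrtr_gt0 ltr0n.
rewrite -ler_pdivrMl//; apply: closure_dist_ge ey ez _.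
move=> _ _ [a Ka <-] [b Kb <-]; rewrite !word_map_cat.
rewrite ler_pdivrMl//; apply: (le_trans _ (word_map_ge ifs _ _ _)).
by rewrite ler_pM2l ?(word_ratio_gt0 ifs)// lam_sep.
Qed.

Lemma cantor_hausdorff_measure_neq0 : (0 < d)%N ->
  hausdorff_measure q (limsup_words (fun w =>
    closed_ball (word_map f w x) (word_ratio c w `^ delta))) != 0.
Proof.
move=> d0; pose e (a : R) := digit N a.
have eN a i : (e a i < N)%N by exact: digit_lt.
have [phi phiP] := choice (fun a => address_limit (e a)).
have A0 : 0 < A by rewrite sqrtr_gt0 ltr0n.
(* The constant is that of [address_limit_dist], raised to the power [q] by admissibility. *)
apply: (@hausdorff_measure_neq0 _ _ _ phi ((A / sigma) `^ q)) => //.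
- by rewrite powR_gt0// divr_gt0.
- by move=> a _; apply: address_limit_limsup (phiP a).
move=> a b a01 b01; have [->|ab] := eqVneq a b.
  by rewrite subrr normr0 mulr_ge0 ?powR_ge0.
have [k /eqP ekab eab] := neq_digit N_gt1 a01 b01 ab.
apply: le_trans (eq_digits_dist N_gt1 a01 b01 eab) _.
apply: le_trans (address_admissible k (eN a)) _.
rewrite -powRM ?divr_ge0// ?(ltW A0) ?(ltW sigma_gt0)//.
apply: ge0_ler_powR => //; rewrite ?nnegrE.
- exact/ltW/(word_ratio_gt0 ifs).
- by rewrite mulr_ge0// divr_ge0// ltW.
rewrite mulrAC ler_pdivlMr//.
exact: (address_limit_dist (eN a) (eN b) eab ekab (phiP a) (phiP b)).
Qed.

End cantor.

(** * Upper bound *)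

(** Hausdorff covers are sequences, whereas the balls are indexed by words; integers coding no word
    contribute 0. *)
Lemma nneseries_pickle (R : realType) (T : countType) (g : T -> \bar R) :
  (forall w, 0 <= g w)%E ->
  (\sum_(0 <= k <oo) (if pickle_inv k is Some w then g w else 0) =
   \esum_(w in [set: T]) g w)%E.
Proof.
move=> g0; pose h k := (if pickle_inv k is Some w then g w else 0)%E.
have h0 k : (0 <= h k)%E by rewrite /h; case: pickle_inv.
rewrite (nneseries_esumT h0) (eq_esum (b := h \o pickle)); last first.
  by move=> w _; rewrite /h /= pickleK_inv.
rewrite -(@esum_image _ _ _ [set: T] pickle h);
  last by move=> a b _ _; exact: (pcan_inj pickleK_inv).
rewrite [RHS]esum_mkcond; apply: eq_esum => k _; case: ifPn => // kT.
rewrite /h; case E : pickle_inv => [w|//].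
case/negP: kT; rewrite inE; exists w => //.
by have := @pickle_invK T k; rewrite E.
Qed.

Section upper_bound.
Context {R : realType} {d m : nat}.
Variables (f : 'I_m -> 'rV[R]_d -> 'rV[R]_d) (c : 'I_m -> R).
Hypothesis ifs : self_similar_IFS f c.

Lemma word_ratio_powR (p : R) w : word_ratio c w `^ p = \prod_(i <- w) c i `^ p.
Proof.
elim: w => [|i w IH]; first by rewrite /word_ratio !big_nil powR1.
rewrite word_ratio_cons big_cons -IH powRM//.
- exact/ltW/(ratio_gt0 ifs).
- exact/ltW/(word_ratio_gt0 ifs).
Qed.

Lemma words_of_sizeE n :
  [set w : seq 'I_m | size w = n] = @tval n 'I_m @` [set: n.-tuple 'I_m].
Proof.
apply/seteqP; split=> [w /= wn|_ [t _ <-]]; last by rewrite /= size_tuple.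
by exists (@Tuple n _ w (introT eqP wn)).
Qed.

Lemma finite_words_of_size n : finite_set [set w : seq 'I_m | size w = n].
Proof. by rewrite words_of_sizeE; apply: finite_image; exact: finite_finset. Qed.

(** Expanding the power by distributivity gives one product for each function from positions to
    letters, that is, for each word. *)
Lemma esum_words_of_size (p : R) n :
  (\esum_(w in [set w : seq 'I_m | size w = n]) (word_ratio c w `^ p)%:E =
   ((\sum_i c i `^ p) ^+ n)%:E)%E.
Proof.
rewrite words_of_sizeE esum_image; last by move=> a b _ _; exact: val_inj.
rewrite esum_fset; [|exact: finite_finset|]; last first.
  by move=> t _; rewrite lee_fin powR_ge0.
have -> : [set: n.-tuple 'I_m] = [set` index_enum {: n.-tuple 'I_m}].
  by apply/seteqP; split=> // t _; exact: mem_index_enum.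
rewrite -fsbig_seq ?index_enum_uniq// sumEFin; congr EFin.
rewrite -[in RHS](card_ord n) -prodr_const bigA_distr_bigA /=.
rewrite (reindex (fun t : n.-tuple 'I_m => [ffun i => tnth t i])) /=.
  apply: eq_bigr => t _; rewrite word_ratio_powR big_tuple.
  by apply: eq_bigr => i _; rewrite ffunE.
exists (fun g : {ffun 'I_n -> 'I_m} => [tuple g i | i < n]) => [t|g] _.
  by apply: eq_from_tnth => i; rewrite tnth_mktuple ffunE.
by apply/ffunP => i; rewrite ffunE tnth_mktuple.
Qed.

Lemma esum_words_le (p : R) : \sum_i c i `^ p < 1 ->
  (\esum_(w in [set: seq 'I_m]) (word_ratio c w `^ p)%:E <=
   ((1 - \sum_i c i `^ p)^-1)%:E)%E.
Proof.
set theta := \sum_i _ => theta1.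
have theta0 : 0 < theta.
  have m0 : (0 < m)%N by apply: leq_trans (ifs.1).
  rewrite /theta (bigD1 (Ordinal m0))//= ltr_pwDl ?powR_gt0 ?(ratio_gt0 ifs)//.
  by rewrite sumr_ge0// => i _; exact: powR_ge0.
have -> : [set: seq 'I_m] = \bigcup_n [set w : seq 'I_m | size w = n].
  by apply/seteqP; split=> // w _; exists (size w).
rewrite nneseries_sum_bigcup; last first.
- by move=> w; rewrite lee_fin powR_ge0.
- apply/trivIsetP => i j _ _ ij; apply/seteqP; split=> // w [/= -> /eqP].
  by rewrite (negbTE ij).
apply: lime_le.
  apply: is_cvg_nneseries => n _ _; apply: esum_ge0 => w _.
  by rewrite lee_fin powR_ge0.
apply: nearW => n; under eq_bigr do rewrite esum_words_of_size.
rewrite sumEFin lee_fin -[leRHS]mul1r.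
have := @geometric_le_lim _ n 1 theta ler01 theta0.
rewrite gtr0_norm// => /(_ theta1); rewrite /series /=.
by under eq_bigr do rewrite mul1r.
Qed.

Lemma sum_powR_lt (s p : R) : s < p -> \sum_i c i `^ p < \sum_i c i `^ s.
Proof.
move=> sp; have m0 : (0 < m)%N by apply: leq_trans (ifs.1).
have lt i : c i `^ p < c i `^ s.
  have ci0 := ratio_gt0 ifs i.
  rewrite -[p](subrK s) powRD ?(gt_eqF ci0) ?implybT//.
  have : c i `^ (p - s) < 1 `^ (p - s).
    by rewrite gt0_ltr_powR ?subr_gt0// ?nnegrE ?(ltW ci0)// (ratio_lt1 ifs).
  by rewrite powR1 gtr_pMl ?powR_gt0.
rewrite (bigD1 (Ordinal m0))//= [ltRHS](bigD1 (Ordinal m0))//=.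
by rewrite ltr_leD// ler_sum// => i _; exact: ltW.
Qed.

Lemma hausdorff_measure_limsup_words_eq0 (s delta q : R) (x : 'rV[R]_d) :
  is_similarity_dimension c s -> 1 <= delta -> 0 <= q -> s < delta * q ->
  hausdorff_measure q (limsup_words (fun w =>
    closed_ball (word_map f w x) (word_ratio c w `^ delta))) = 0%E.
Proof.
move=> sdim delta1 q0 sp; pose p := delta * q; pose p' := (p + s) / 2.
(* [s < p'] makes the series over words converge, and [p' < p] leaves a factor that vanishes as [n]
   grows. *)
have sp' : s < p' by rewrite /p' /p; lra.
have p'p : p' < p by rewrite /p' /p; lra.
have := sum_powR_lt sp'; rewrite sdim => /[dup] theta1 /esum_words_le.
set B := (_^-1) => leB; have B0 : 0 < B by rewrite invr_gt0 subr_gt0.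
have [[k0 C] /= [_ /andP[C0 C1]] kcC] := ratio_bounds ifs.
have cC i : c i <= C by case/andP: (kcC i).
apply/eqP; rewrite eq_le hausdorff_measure_ge0 andbT.
apply: ge_ereal_sup => _ [e /= e0 <-]; apply/lee_addgt0Pr => eps eps0.
rewrite add0e.
have two0 : 0 < (2 : R) `^ q by rewrite powR_gt0.
(* [eta] solves [2]^ q * eta [^ (p - p') * B = eps]; the bound [e / 2] on [C ^+ n] will keep the
   diameters below [e]. *)
pose eta := (eps / (2 `^ q * B)) `^ (p - p')^-1.
have eta0 : 0 < eta by rewrite powR_gt0// divr_gt0// mulr_gt0.
have [|n] := @expr_lt_small _ C (Num.min (e / 2) eta) C0 C1.
  by rewrite lt_min eta0 divr_gt0.
rewrite lt_min => /andP[Ce Ceta].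
pose ball w : set 'rV[R]_d :=
  closed_ball (word_map f w x) (word_ratio c w `^ delta).
pose U k : set 'rV[R]_d :=
  if pickle_inv k is Some w then if (n <= size w)%N then ball w else set0
  else set0.
have wC w : (n <= size w)%N -> word_ratio c w <= C ^+ n.
  move=> nw; apply: le_trans (word_ratio_le_expr ifs w cC) _.
  by rewrite ler_wiXn2l// ltW.
have balld w a b : ball w a -> ball w b ->
    `|a - b| <= 2 * word_ratio c w `^ delta.
  rewrite /ball closed_ballE ?powR_gt0 ?(word_ratio_gt0 ifs)// /closed_ball_ /=.
  move=> wa wb; apply: le_trans (ler_distD (word_map f w x) _ _) _.
  by rewrite [X in X + _]distrC mulrDl mul1r lerD.
apply: (@le_trans _ _ (\sum_(0 <= k <oo) diam_pow q (U k))%E).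
  apply: ereal_inf_lbound; exists U => //; split=> [y yinf|k].
    (* A point missed by the cover lies only in balls of words shorter than [n], of which there are
       finitely many. *)
    apply: contrapT => yU; apply: yinf.
    apply: (@sub_finite_set _ _ (\bigcup_(j < n) [set w | size w = j])).
      move=> w /= wy; exists (size w) => //=; rewrite ltnNge; apply/negP => nw.
      by apply: yU; exists (pickle w) => //; rewrite /U pickleK_inv nw.
    apply: bigcup_finite => [|j _]; first exact: finite_II.
    exact: finite_words_of_size.
  apply: diameter_le => a b; rewrite /U; case: pickle_inv => // w.
  case: ifPn => // nw wa wb; apply: le_trans (balld _ _ _ wa wb) _.
  have : word_ratio c w `^ delta <= word_ratio c w.
    by apply: ge1r_powR => //; rewrite (word_ratio_gt0 ifs) (word_ratio_le1 ifs).
  have := wC w nw; lra.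
pose a : R := 2 `^ q * (C ^+ n) `^ (p - p').
have a0 : 0 <= a by rewrite mulr_ge0 ?powR_ge0.
apply: (@le_trans _ _ (\sum_(0 <= k <oo) (a%:E *
   (if pickle_inv k is Some w then (word_ratio c w `^ p')%:E else 0)))%E).
  apply: lee_nneseries => [k _ _|k _]; first exact: diam_pow_ge0.
  rewrite /U; case: pickle_inv => [w|]; last by rewrite /diam_pow eqxx mule0.
  case: ifPn => nw; last by rewrite /diam_pow eqxx lee_fin mulr_ge0 ?powR_ge0.
  apply: le_trans (diam_pow_le q0 (@balld w)) _.
  have w0 := word_ratio_gt0 ifs w.
  rewrite -EFinM lee_fin powRM ?powR_ge0// -powRrM -/p /a -mulrA.
  rewrite ler_pM2l// -[X in _ `^ X](subrK p') powRD ?(gt_eqF w0) ?implybT//.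
  rewrite ler_wpM2r ?powR_ge0// ge0_ler_powR ?wC ?subr_ge0 ?(ltW p'p)//.
    by rewrite nnegrE ltW.
  by rewrite nnegrE exprn_ge0.
rewrite nneseriesZl; last first.
  by move=> k _; case: pickle_inv => // w; rewrite lee_fin powR_ge0.
rewrite (nneseries_pickle (g := fun w => (word_ratio c w `^ p')%:E)); last first.
  by move=> w; rewrite lee_fin powR_ge0.
apply: (@le_trans _ _ (a%:E * B%:E)%E); first by rewrite lee_wpmul2l ?lee_fin.
have pp' : 0 < p - p' by rewrite subr_gt0.
have etaE : eta `^ (p - p') = eps / (2 `^ q * B).
  rewrite /eta -powRrM mulVf ?gt_eqF// powRr1// ltW// divr_gt0//.
  exact: mulr_gt0.
have : (C ^+ n) `^ (p - p') <= eta `^ (p - p').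
  apply: ge0_ler_powR; rewrite ?nnegrE ?exprn_ge0//; apply: ltW => //.
rewrite etaE ler_pdivlMr ?mulr_gt0// -EFinM lee_fin.
by rewrite /a mulrAC [X in X <= _ -> _]mulrC.
Qed.

End upper_bound.

(** * Lower bound *)

Section lower_bound.
Context {R : realType} {d m : nat}.
Variables (f : 'I_m -> 'rV[R]_d -> 'rV[R]_d) (c : 'I_m -> R).
Variables (K : set 'rV[R]_d).
Hypothesis d_gt0 : (0 < d)%N.
Hypothesis ifs : self_similar_IFS f c.
Hypothesis attr : is_attractor f K.

Lemma hausdorff_measure_limsup_words_neq0 (s delta q : R) (x : 'rV[R]_d) :
  s%:E = dim_H K -> K x -> 1 <= delta -> 0 <= q -> delta * q < s ->
  hausdorff_measure q (limsup_words (fun w =>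
    closed_ball (word_map f w x) (word_ratio c w `^ delta))) != 0%E.
Proof.
move=> sE Kx delta1 q0 us.
have [[k C] /= [kk CC] kcC] := ratio_bounds ifs.
have [D D1 KD] := attractor_bounded attr.
have u0 : 0 <= delta * q by rewrite mulr_ge0// (le_trans _ delta1).
have [N [rho [sigma [lam [[N1 rho01 sigma0 NU] [lamP lam_sep]]]]]] :=
  separated_subsystem d_gt0 ifs attr kk CC kcC D1 KD sE
    (introT andP (conj u0 us)).
have A1 := @sqrt_dim_ge1 R d d_gt0.
set A := Num.sqrt _ in A1.
pose M := A * D.
have M1 : 1 <= M by rewrite /M; nra.
have M0 : 0 < M by lra.
have /andP[k0 k1] := kk.
pose rad w := word_ratio c w `^ (delta - 1) / M.
have radE w : word_ratio c w * rad w = word_ratio c w `^ delta / M.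
  have w0 := word_ratio_gt0 ifs w.
  rewrite mulrA -{1}[word_ratio c w]powRr1 ?(ltW w0)//.
  by rewrite -powRD ?(gt_eqF w0) ?implybT// addrC subrK.
have [v vP] : {v : seq 'I_m -> seq 'I_m & forall w,
    exists2 z, K z /\ x = word_map f (v w) z &
      k * rad w <= word_ratio c (v w) <= rad w}.
  apply: (@choice _ _ (fun w t => exists2 z, K z /\ x = word_map f t z &
      k * rad w <= word_ratio c t <= rad w)) => w.
  apply: (attractor_word ifs attr kk CC kcC Kx).
  have w0 := word_ratio_gt0 ifs w.
  rewrite divr_gt0 ?powR_gt0//= ler_pdivrMr// mul1r (le_trans _ M1)//.
  rewrite -[leRHS](powRr0 (word_ratio c w)) ger_powR ?subr_ge0//.
  by rewrite w0 (word_ratio_le1 ifs).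
(* In [kappa = k / M], [k] is the loss in [attractor_word] and [M] comes from [rad]. *)
apply: (@cantor_hausdorff_measure_neq0 _ _ _ f c K ifs attr delta q x N rho
  sigma (k / M) lam v) => //.
- by rewrite divr_gt0.
- move=> w; have [z _ /andP[h _]] := vP w.
  rewrite word_ratio_cat mulrAC -mulrA -radE mulrCA.
  by rewrite ler_pM2l// (word_ratio_gt0 ifs).
- move=> w z Kz; have [z' [Kz' xE] /andP[_ h]] := vP w.
  rewrite {1}xE -word_map_cat; apply: le_trans (word_map_le ifs _ _ _) _.
  rewrite word_ratio_cat.
  have -> : word_ratio c w `^ delta = A * (word_ratio c w * rad w) * D.
    by rewrite radE /M; field; rewrite !gt_eqF//; lra.
  have w0 := word_ratio_gt0 ifs w.
  have v0 := word_ratio_gt0 ifs (v w).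
  rewrite ler_pM ?KD// ?mulr_ge0 ?(ltW w0) ?(ltW v0)//.
  by rewrite ler_pM2l ?(lt_le_trans ltr01 A1)// ler_pM2l.
Qed.

End lower_bound.

Theorem theorem2p15 (R : realType) (d m : nat)
    (f : 'I_m -> 'rV[R]_d -> 'rV[R]_d) (c : 'I_m -> R)
    (K : set 'rV[R]_d) (s : R) :
  (0 < d)%N ->
  self_similar_IFS f c ->
  dimension_regular f c ->
  is_attractor f K ->
  is_similarity_dimension c s ->
  s%:E = dim_H K ->
  forall (x : 'rV[R]_d) (delta : R), K x -> 1 <= delta ->
  dim_H (limsup_words (fun w : seq 'I_m =>
           closed_ball (word_map f w x) (word_ratio c w `^ delta)))
  = (dim_H K * (delta^-1)%:E)%E.
Proof.
move=> d0 ifs _ attr sdim sE x delta Kx delta1.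
have delta0 : 0 < delta by exact: lt_le_trans delta1.
have s0 : 0 <= s.
  rewrite -lee_fin sE; apply: le_ereal_inf_tmp => _ [q [q0 _] <-].
  by rewrite lee_fin.
rewrite -sE -EFinM; apply/eqP; rewrite eq_le; apply/andP; split.
  (* The measure is shown to vanish only above the critical exponent, hence the margin [e]. *)
  apply/lee_addgt0Pr => e e0; rewrite -EFinD; apply: ereal_inf_lbound.
  exists (s / delta + e) => //; split.
    by rewrite addr_ge0 ?divr_ge0// ltW.
  apply: (hausdorff_measure_limsup_words_eq0 ifs x sdim delta1).
    by rewrite addr_ge0 ?divr_ge0// ltW.
  by rewrite mulrDr mulrCA divff ?gt_eqF// mulr1 ltrDl mulr_gt0.
apply: le_ereal_inf_tmp => _ [q [q0 Hq] <-]; rewrite lee_fin leNgt.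
apply/negP; rewrite ltr_pdivlMr// mulrC => qs.
have := hausdorff_measure_limsup_words_neq0 d0 ifs attr sE Kx delta1 q0 qs.
by rewrite Hq eqxx.
Qed.
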